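(* Over all \textsc{Snort} positions (finite simple graphs $G$), the difference $t(G)-\deg(G)$ is unbounded; that is, for every real $M$ there is a finite simple graph $G$ such that \textsc{Snort} played on $G$ satisfies $t(G)-\deg(G)>M$.
   Context: \textsc{Snort} is a two-player normal-play combinatorial game (the player unable to move loses) between Left (blue) and Right (red), played on a finite simple graph; players alternately colour an uncoloured vertex in their own colour, and a player may not colour a vertex adjacent to a vertex coloured by the opponent. $t(G)$ denotes the temperature (in the standard sense of combinatorial game theory, via thermographs) of the game \textsc{Snort} played on the uncoloured graph $G$, and $\deg(G)$ denotes the maximum degree of a vertex of $G$. *)

(* Defs.v *)
From HB Require Import structures.
From mathcomp Require Import all_boot all_order all_algebra.
From mathcomp Require Import boolp classical_sets reals constructive_ereal.
Set Implicit Arguments. Unset Strict Implicit. Unset Printing Implicit Defensive.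
Import Order.TTheory GRing.Theory Num.Theory.

Inductive game : Type := Game : seq game -> seq game -> game.

Definition leftopts (G : game) : seq game := let: Game l _ := G in l.
Definition rightopts (G : game) : seq game := let: Game _ r := G in r.

Fixpoint gdepth (G : game) : nat :=
  let: Game l r := G in
  (foldr maxn 0%N ((fix f s := if s is g :: s' then gdepth g :: f s' else [::]) l
     ++ (fix f s := if s is g :: s' then gdepth g :: f s' else [::]) r)).+1.

(* G <= H  iff  no G^L with H <= G^L and no H^R with H^R <= G
   (computed with enough fuel: depth G + depth H). *)
Fixpoint gle_fuel (n : nat) (G H : game) : bool :=
  match n with
  | 0%N => true
  | n'.+1 =>
      ~~ has (fun gl => gle_fuel n' H gl) (leftopts G) &&
      ~~ has (fun hr => gle_fuel n' hr G) (rightopts H)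
  end.

Definition gle (G H : game) : bool := gle_fuel (gdepth G + gdepth H) G H.
Definition game_eq (G H : game) : bool := gle G H && gle H G.

(* Canonical games of integers and dyadic rationals:
   dyadic n k is the canonical form of k / 2^n. *)
Definition intgame (k : int) : game :=
  match k with
  | Posz m => iter m (fun g => Game [:: g] [::]) (Game [::] [::])
  | Negz m => iter m.+1 (fun g => Game [::] [:: g]) (Game [::] [::])
  end.

Fixpoint dyadic (n : nat) (k : int) : game :=
  match n with
  | 0%N => intgame k
  | n'.+1 =>
      if ~~ odd `|k|%N then dyadic n' (k %/ 2)%Z
      else Game [:: dyadic n' ((k - 1) %/ 2)%Z] [:: dyadic n' ((k + 1) %/ 2)%Z]
  end.

Definition equals_number (G : game) (kn : int * nat) : bool :=
  game_eq G (dyadic kn.2 kn.1) && ((kn.2 == 0%N) || odd `|kn.1|%N).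

Definition number_of (G : game) : option (int * nat) :=
  match pselect (exists kn, equals_number G kn) with
  | left H => Some (proj1_sig (cid H))
  | right _ => None
  end.

(* Thermographs (Siegel, CGT, II.5).                                   *)
Section Thermograph.
Variable R : realType.
Local Open Scope ring_scope.
Local Open Scope ereal_scope.

Definition walls := ((R -> R) * (R -> R))%type. (* (left wall, right wall) *)

Definition lscaffold (wl : seq walls) (t : R) : \bar R :=
  \big[maxe/-oo]_(w <- wl) ((w.2 t - t)%R)%:E.
Definition rscaffold (wr : seq walls) (t : R) : \bar R :=
  \big[mine/+oo]_(w <- wr) ((w.1 t + t)%R)%:E.

Definition meet_temp (wl wr : seq walls) : R :=
  inf [set t : R | (-1 <= t)%R /\ lscaffold wl t <= rscaffold wr t].

Definition dyval (kn : int * nat) : R := (kn.1%:~R / (2 ^+ kn.2)%:R)%R.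

Definition node_walls (G : game) (wl wr : seq walls) : walls :=
  match number_of G with
  | Some kn => (fun _ => dyval kn, fun _ => dyval kn)
  | None =>
      let s := meet_temp wl wr in
      (fun t => fine (lscaffold wl (Num.min t s)),
       fun t => fine (rscaffold wr (Num.min t s)))
  end.

(* walls L_t(G), R_t(G) (meaningful for t >= -1) *)
Fixpoint thermograph (G : game) : walls :=
  let: Game l r := G in
  node_walls G
    ((fix f s := if s is g :: s' then thermograph g :: f s' else [::]) l)
    ((fix f s := if s is g :: s' then thermograph g :: f s' else [::]) r).

Definition temperature (G : game) : R :=
  match number_of G with
  | Some kn => if kn.2 == 0%N then (-1)%R else (- (2 ^+ kn.2)%:R^-1)%R
  | None => meet_temp [seq thermograph g | g <- leftopts G]
                      [seq thermograph g | g <- rightopts G]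
  end.

End Thermograph.

Definition simple_graph (T : finType) (e : rel T) : Prop :=
  symmetric e /\ irreflexive e.

(* colouring: None = uncoloured, Some true = Left (blue), Some false = Right (red) *)
Definition colouring (T : finType) := {ffun T -> option bool}.

Definition snort_legal (T : finType) (e : rel T) (c : colouring T) (b : bool) (v : T) : bool :=
  (c v == None) && [forall u, e v u ==> (c u != Some (~~ b))].

Definition snort_move (T : finType) (c : colouring T) (b : bool) (v : T) : colouring T :=
  [ffun u => if u == v then Some b else c u].

(* game tree of a Snort position; fuel n >= number of uncoloured vertices *)
Fixpoint snort_fuel (T : finType) (e : rel T) (n : nat) (c : colouring T) : game :=
  match n with
  | 0%N => Game [::] [::]
  | n'.+1 =>
      Game [seq snort_fuel e n' (snort_move c true v) | v <- enum T & snort_legal e c true v]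
           [seq snort_fuel e n' (snort_move c false v) | v <- enum T & snort_legal e c false v]
  end.

Definition snort (T : finType) (e : rel T) : game :=
  snort_fuel e #|T| [ffun _ => None].

Definition max_degree (T : finType) (e : rel T) : nat :=
  \max_(v : T) #|[set u | e v u]|.

(* Main.v *)
(* Join a root to [n] vertices and hang four leaves on each of these; for [n >= 5]
   the maximum degree is [n]. When Left colours the root, each neighbour of the
   root is the centre of a star that only Left may colour. Left takes a centre
   to gain its four leaves, Right takes a leaf to make the centre unplayable, so
   each star is worth about [{4 | 0}], of mean 2. The sum of the stars has mean
   at least [2 n - 1], and the same holds with the players exchanged, so that
   the tree has temperature at least [2 n - 2].

   The mean is bounded through the walls of the thermograph: a position with [m]
   stars and [j] vertices reserved for Left has walls above [j - 1 + 2 m] from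
   temperature 2 on. Positions that are equal to a number are bounded separately,
   by comparing them with integers. *)
Require Import Defs.
From HB Require Import structures.
From mathcomp Require Import all_boot all_order all_algebra.
From mathcomp Require Import boolp classical_sets reals constructive_ereal.
From mathcomp Require Import zify lra.
Set Implicit Arguments.
Unset Strict Implicit.
Unset Printing Implicit Defensive.
Import Order.TTheory GRing.Theory Num.Theory.
Local Open Scope ring_scope.

(** * Games and the order on them *)

HB.instance Definition _ := gen_eqMixin game.

Lemma gdepth_option (G H : game) :
  H \in leftopts G ++ rightopts G -> (gdepth H < gdepth G)%N.
Proof.
case: G => l r /=.
set f := (fix f s := if s is g :: s' then gdepth g :: f s' else [::]).
have -> (s : seq game) : f s = [seq gdepth g | g <- s] by elim: s => //= g s ->.
rewrite -map_cat ltnS; elim: (l ++ r) => //= g s IH.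
rewrite inE leq_max => /orP[/eqP->|/IH->]; first by rewrite leqnn.
by rewrite orbT.
Qed.

Lemma gdepth_left (G H : game) : H \in leftopts G -> (gdepth H < gdepth G)%N.
Proof. by move=> h; apply: gdepth_option; rewrite mem_cat h. Qed.

Lemma gdepth_right (G H : game) : H \in rightopts G -> (gdepth H < gdepth G)%N.
Proof. by move=> h; apply: gdepth_option; rewrite mem_cat h orbT. Qed.

(** Options are nested inside lists, so the generated principle for [game] gives no hypothesis on
    them; induction on [gdepth] does. *)
Lemma game_option_ind (P : game -> Prop) :
  (forall G, (forall H, H \in leftopts G -> P H) ->
             (forall H, H \in rightopts G -> P H) -> P G) ->
  forall G, P G.
Proof.
move=> step G; have [n] := ubnP (gdepth G); elim: n G => // n IH G ltGn.
apply: step => H.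
- by move=> /gdepth_left lt; apply: IH; apply: leq_trans lt _.
- by move=> /gdepth_right lt; apply: IH; apply: leq_trans lt _.
Qed.

(** Depths are positive and passing to an option lowers their sum, so the default [true] at zero
    fuel is never reached. *)
Lemma gle_fuel_stable (n m : nat) (G H : game) :
  (gdepth G + gdepth H <= n)%N -> (gdepth G + gdepth H <= m)%N ->
  gle_fuel n G H = gle_fuel m G H.
Proof.
have pos (K : game) : (0 < gdepth K)%N by case: K.
elim: n m G H => [|n IH] m G H; first by have := pos G; lia.
case: m => [|m] hn hm; first by have := pos G; lia.
rewrite /=; congr (~~ _ && ~~ _); apply: eq_in_has => K.
- by move=> /gdepth_left lt; apply: IH; lia.
- by move=> /gdepth_right lt; apply: IH; lia.
Qed.

Lemma gleE (G H : game) :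
  gle G H = ~~ has (gle H) (leftopts G) && ~~ has (gle^~ G) (rightopts H).
Proof.
have pos (K : game) : (0 < gdepth K)%N by case: K.
rewrite /gle; case E: (gdepth G + gdepth H)%N => [|n] /=.
  by have := pos G; lia.
congr (~~ _ && ~~ _); apply: eq_in_has => K.
- by move=> /gdepth_left lt; apply: gle_fuel_stable; lia.
- by move=> /gdepth_right lt; apply: gle_fuel_stable; lia.
Qed.

Lemma gleP (G H : game) :
  reflect ((forall K, K \in leftopts G -> ~~ gle H K) /\
           (forall K, K \in rightopts H -> ~~ gle K G)) (gle G H).
Proof.
rewrite gleE -!all_predC.
by apply: (iffP andP) => -[/allP hl /allP hr].
Qed.

Lemma left_gleN (G H K : game) : K \in leftopts G -> gle H K -> ~~ gle G H.
Proof. by move=> KG HK; apply/negP => /gleP[/(_ K KG)]; rewrite HK. Qed.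

Lemma right_gleN (G H K : game) : K \in rightopts H -> gle K G -> ~~ gle G H.
Proof. by move=> KH KG; apply/negP => /gleP[_ /(_ K KH)]; rewrite KG. Qed.

(** An option refuting [G <= K] would, by transitivity for a smaller triple, refute [G <= H] or
    [H <= K]. The triples rotate, whence the induction on the sum of the three depths. *)
Lemma gle_trans (G H K : game) : gle G H -> gle H K -> gle G K.
Proof.
have [n] := ubnP (gdepth G + gdepth H + gdepth K); elim: n G H K => // n IH G H K.
move=> lt GH HK; apply/gleP; split=> X XO; apply/negP => le.
- have ltX := gdepth_left XO.
  suff HX : gle H X by have /gleP[/(_ X XO)] := GH; rewrite HX.
  by apply: (IH H K X) => //; lia.
- have ltX := gdepth_right XO.
  suff XH : gle X H by have /gleP[_ /(_ X XO)] := HK; rewrite XH.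
  by apply: (IH X G H) => //; lia.
Qed.

(** * Negation, and comparison of dyadic numbers with integers *)

Fixpoint neg (G : game) : game :=
  let: Game l r := G in Game (map neg r) (map neg l).

Lemma leftopts_neg (G : game) : leftopts (neg G) = map neg (rightopts G).
Proof. by case: G. Qed.

Lemma rightopts_neg (G : game) : rightopts (neg G) = map neg (leftopts G).
Proof. by case: G. Qed.

Lemma negK : involutive neg.
Proof.
elim/game_option_ind => -[l r] /= IHl IHr.
by congr Game; rewrite -map_comp -[RHS]map_id; apply/eq_in_map => K; [apply: IHl | apply: IHr].
Qed.

Lemma gle_neg (G H : game) : gle (neg G) (neg H) = gle H G.
Proof.
have [n] := ubnP (gdepth G + gdepth H); elim: n G H => // n IH G H lt.
rewrite !gleE leftopts_neg rightopts_neg !has_map andbC.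
congr (~~ _ && ~~ _); apply: eq_in_has => K /=.
- by move=> /gdepth_left ltK; rewrite IH //; lia.
- by move=> /gdepth_right ltK; rewrite IH //; lia.
Qed.

Lemma intgame_neg (k : int) : neg (intgame k) = intgame (- k).
Proof.
have pos m : neg (intgame (Posz m)) = intgame (- Posz m).
  case: m => // m; rewrite -NegzE /=; congr Game; congr cons.
  by elim: m => //= m ->.
case: k => [m|m] //.
by rewrite NegzE -pos negK opprK.
Qed.

Lemma leftopts_intgame (y : int) :
  leftopts (intgame y) = if 0 < y then [:: intgame (y - 1)] else [::].
Proof.
case: y => [[|m]|m] //.
by rewrite (_ : Posz m.+1 - 1 = Posz m) //; lia.
Qed.

Lemma rightopts_intgame (y : int) :
  rightopts (intgame y) = if y < 0 then [:: intgame (y + 1)] else [::].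
Proof.
case: y => [m|m]; first by case: m.
case: m => [|m] //.
by rewrite (_ : Negz m.+1 + 1 = Negz m) //; lia.
Qed.

Lemma dyadic_neg (n : nat) (k : int) : neg (dyadic n k) = dyadic n (- k).
Proof.
elim: n k => [|n IH] k; first exact: intgame_neg.
rewrite /= abszN; case: ifPn => odd_k; first by rewrite IH; congr dyadic; lia.
by rewrite /= !IH; congr (Game [:: dyadic _ _] [:: dyadic _ _]); lia.
Qed.

(* [k / 2 ^ n <= y] is phrased as [k <= y * 2 ^ n]. *)
Lemma dyadic_intgame (n : nat) (k y : int) :
  (k <= y * (2 ^ n)%:Z -> gle (dyadic n k) (intgame y)) /\
  (k < y * (2 ^ n)%:Z -> ~~ gle (intgame y) (dyadic n k)).
Proof.
elim: n k y => [|n IH] k y.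
  have [N] := ubnP (`|k| + `|y|); elim: N k y => // N IHN k y lt; rewrite /= !expn0 !mulr1.
  split=> le.
  - apply/gleP; rewrite leftopts_intgame rightopts_intgame; split=> K.
    + case: ifP => // k0; rewrite inE => /eqP->.
      by have [_] := IHN (k - 1) y ltac:(lia); apply; lia.
    + case: ifP => // y0; rewrite inE => /eqP->.
      by have [_] := IHN k (y + 1) ltac:(lia); apply; lia.
  - have [y0|y0] := ltP 0 y.
      apply: (left_gleN (K := intgame (y - 1))).
        by rewrite leftopts_intgame y0 inE.
      by have [] := IHN k (y - 1) ltac:(lia); rewrite expn0 mulr1 => + _; apply; lia.
    apply: (right_gleN (K := intgame (k + 1))).
      by rewrite rightopts_intgame ifT ?inE //; lia.
    by have [] := IHN (k + 1) y ltac:(lia); rewrite expn0 mulr1 => + _; apply; lia.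
have E : y * (2 ^ n.+1)%:Z = 2 * (y * (2 ^ n)%:Z) by rewrite expnS; lia.
have p0 : 0 < (2 ^ n)%:Z by rewrite ltz_nat expn_gt0.
(* Right can move from a negative [y] to [y + 1], so the bound at [y + 1] is needed too. Once
   [y * 2 ^ n] and [2 ^ n] are generalised, the rest is linear. *)
have IHS k' := IH k' (y + 1); have IHy k' := IH k' y.
rewrite mulrDl mul1r in IHS; rewrite E.
move: (y * (2 ^ n)%N%:Z) ((2 ^ n)%N%:Z) p0 IHS IHy => z p p0 IHS IHy {E} /=.
case: ifPn => odd_k.
  by have [le lt] := IHy (k %/ 2)%Z; split=> ?; [apply: le | apply: lt]; lia.
split=> lt.
- apply/gleP; split=> K /=; first rewrite inE => /eqP->.
    by have [_] := IHy ((k - 1) %/ 2)%Z; apply; lia.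
  rewrite rightopts_intgame; case: ifP => // y0; rewrite inE => /eqP->.
  apply: (@right_gleN _ _ (dyadic n ((k + 1) %/ 2)%Z)); first by rewrite inE.
  by have [+ _] := IHS ((k + 1) %/ 2)%Z; apply; lia.
- apply: (@right_gleN _ _ (dyadic n ((k + 1) %/ 2)%Z)); first by rewrite inE.
  by have [+ _] := IHy ((k + 1) %/ 2)%Z; apply; lia.
Qed.

(** Turns a comparison of games into an inequality of reals: if the number were at most [y],
    transitivity through its dyadic form would give [G <= y]. *)
Lemma game_eq_dyadic_gt (R : realType) (G : game) (kn : int * nat) (y : int) :
  equals_number G kn -> ~~ gle G (intgame y) -> y%:~R < dyval R kn.
Proof.
case: kn => k n /andP[/andP[GX XG] _] /negP Gy; rewrite /dyval /=.
rewrite ltr_pdivlMr ?ltr0n ?natrXE ?expn_gt0 // ltNge; apply/negP => le.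
apply: Gy; apply: gle_trans GX _; apply: (proj1 (dyadic_intgame _ _ _)).
by rewrite -(ler_int R) intrM /=.
Qed.

(** * Walls of thermographs *)

Section Walls.
Variable R : realType.

(** Nonemptiness keeps the scaffold finite; over the empty list it is infinite and [fine] sends it
    to 0. *)
Lemma lscaffold_max (wl : seq (walls R)) (t : R) : wl != [::] ->
  [/\ lscaffold wl t = (fine (lscaffold wl t))%:E,
      forall w, w \in wl -> w.2 t - t <= fine (lscaffold wl t) &
      exists2 w, w \in wl & fine (lscaffold wl t) = w.2 t - t].
Proof.
elim: wl => // w wl IH _; rewrite /lscaffold big_cons -/(lscaffold wl t).
case: wl IH => [_|w' wl /(_ isT) [-> le [v v_in E]]].
  rewrite /lscaffold big_nil maxeNy; split=> // [v|]; first by rewrite inE => /eqP->.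
  by exists w; rewrite ?inE.
move: (_ :: wl) le v_in E => vs; move: (fine (lscaffold vs t)) => r le v_in E; rewrite -EFin_max /=; split=> // [u|].
- by rewrite inE le_max => /predU1P[->|/le->]; rewrite ?lexx ?orbT.
- case: leP => _; first by exists v; rewrite // inE v_in orbT.
  by exists w; rewrite // inE eqxx.
Qed.

Lemma rscaffold_min (wr : seq (walls R)) (t : R) : wr != [::] ->
  [/\ rscaffold wr t = (fine (rscaffold wr t))%:E,
      forall w, w \in wr -> fine (rscaffold wr t) <= w.1 t + t &
      exists2 w, w \in wr & fine (rscaffold wr t) = w.1 t + t].
Proof.
elim: wr => // w wr IH _; rewrite /rscaffold big_cons -/(rscaffold wr t).
case: wr IH => [_|w' wr /(_ isT) [-> le [v v_in E]]].
  rewrite /rscaffold big_nil miney; split=> // [v|]; first by rewrite inE => /eqP->.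
  by exists w; rewrite ?inE.
move: (_ :: wr) le v_in E => vs; move: (fine (rscaffold vs t)) => r le v_in E; rewrite -EFin_min /=; split=> // [u|].
- by rewrite inE ge_min => /predU1P[->|/le->]; rewrite ?lexx ?orbT.
- case: leP => _; first by exists w; rewrite // inE eqxx.
  by exists v; rewrite // inE v_in orbT.
Qed.

Lemma lscaffold_eqP (wl wr : seq (walls R)) t : wl != [::] -> wr != [::] ->
  (lscaffold wl t <= rscaffold wr t)%E =
  (fine (lscaffold wl t) <= fine (rscaffold wr t)).
Proof.
by move=> /(lscaffold_max t)[-> _ _] /(rscaffold_min t)[-> _ _]; rewrite lee_fin.
Qed.

(** Slopes in [-1, 0] for the left wall and in [0, 1] for the right wall, stated without
    derivatives. *)
Definition tame (w : walls R) := forall s t, s <= t ->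
  w.1 t <= w.1 s <= w.1 t + (t - s) /\ w.2 s <= w.2 t <= w.2 s + (t - s).

(** Subtracting [t] shifts the slopes of right walls from [0, 1] to [-1, 0], and a maximum keeps
    such bounds. *)
Lemma lscaffold_tame (wl : seq (walls R)) s t :
  (forall w, w \in wl -> tame w) -> s <= t ->
  fine (lscaffold wl t) <= fine (lscaffold wl s) <= fine (lscaffold wl t) + (t - s).
Proof.
move=> tm st; have [->|ne] := eqVneq wl [::].
  by rewrite /lscaffold !big_nil /= lexx add0r subr_ge0.
have [_ les [u uin us]] := lscaffold_max s ne.
have [_ let_ [v vin vt]] := lscaffold_max t ne.
have := les _ vin; have := let_ _ uin.
by have [_] := tm _ vin _ _ st; have [_] := tm _ uin _ _ st; lra.
Qed.

Lemma rscaffold_tame (wr : seq (walls R)) s t :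
  (forall w, w \in wr -> tame w) -> s <= t ->
  fine (rscaffold wr s) <= fine (rscaffold wr t) <= fine (rscaffold wr s) + (t - s).
Proof.
move=> tm st; have [->|ne] := eqVneq wr [::].
  by rewrite /rscaffold !big_nil /= lexx add0r subr_ge0.
have [_ les [u uin us]] := rscaffold_min s ne.
have [_ let_ [v vin vt]] := rscaffold_min t ne.
have := les _ vin; have := let_ _ uin.
by have [+ _] := tm _ vin _ _ st; have [+ _] := tm _ uin _ _ st; lra.
Qed.

(* Satisfied by [thermograph] and by its reflection [mirror] below, which turns
   bounds in favour of Left into bounds in favour of Right. *)
Definition thermographic (W : game -> walls R) := forall G : game,
  (exists2 kn, equals_number G kn & W G = (fun=> dyval R kn, fun=> dyval R kn)) \/
  (~ exists kn, equals_number G kn) /\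
  let wl := [seq W g | g <- leftopts G] in
  let wr := [seq W g | g <- rightopts G] in
  W G = (fun t => fine (lscaffold wl (Num.min t (meet_temp wl wr))),
         fun t => fine (rscaffold wr (Num.min t (meet_temp wl wr)))).

Lemma thermograph_thermographic : thermographic (thermograph R).
Proof.
case=> l r /=.
set f := (fix f s := if s is g :: s' then thermograph R g :: f s' else [::]).
have -> (s : seq game) : f s = [seq thermograph R g | g <- s] by elim: s => //= g s ->.
rewrite /node_walls /number_of; case: pselect => [ex|nex]; last by right.
by left; exists (sval (cid ex)); first exact: (svalP (cid ex)).
Qed.

Section Thermographic.
Variable W : game -> walls R.
Hypothesis WP : thermographic W.

(** Scaffolds have the right slopes by induction, and cutting the temperature off at [meet_temp] is
    monotone and does not expand distances. *)
Lemma wall_tame G : tame (W G).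
Proof.
elim/game_option_ind: G => G IHl IHr s t st.
have [[kn _ ->]|[_ ->]] /= := WP G; first by rewrite !lexx !lerDl subr_ge0.
have tl w : w \in [seq W g | g <- leftopts G] -> tame w.
  by case/mapP=> g gG ->; exact: IHl _ gG.
have tr w : w \in [seq W g | g <- rightopts G] -> tame w.
  by case/mapP=> g gG ->; exact: IHr _ gG.
set m := meet_temp _ _.
have le : Num.min s m <= Num.min t m by rewrite le_min2.
have := lscaffold_tame tl le; have := rscaffold_tame tr le.
have : Num.min t m - Num.min s m <= t - s by rewrite /Num.min; case: ifP; case: ifP; lra.
by lra.
Qed.

Lemma tame_map (s : seq game) w : w \in [seq W g | g <- s] -> tame w.
Proof. by case/mapP=> g _ ->; apply: wall_tame. Qed.

(** The walls are constant from [meet_temp] on, and that constant is the least value on the left and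
    the greatest on the right. The bound makes the scaffolds of any position with options on both
    sides meet. *)
Lemma wall_bounded G : exists B, forall t, - B <= (W G).1 t /\ (W G).2 t <= B.
Proof.
have [[kn _ ->]|[_ ->]] /= := WP G.
  by exists `|dyval R kn| => t; rewrite ler_norm lerNl ler_normr lexx orbT.
set m := meet_temp _ _; set wl := map W _; set wr := map W _.
exists (`|fine (lscaffold wl m)| + `|fine (rscaffold wr m)|) => t.
have le : Num.min t m <= m by rewrite ge_min lexx orbT.
have /andP[hl _] := lscaffold_tame (@tame_map (leftopts G)) le.
have /andP[hr _] := rscaffold_tame (@tame_map (rightopts G)) le.
have := ler_norm (fine (rscaffold wr m)); have := ler_norm (- fine (lscaffold wl m)).
rewrite normrN; have := normr_ge0 (fine (rscaffold wr m)).
by have := normr_ge0 (fine (lscaffold wl m)); lra.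
Qed.

Lemma walls_bounded (s : seq game) :
  exists B, forall G, G \in s -> forall t, - B <= (W G).1 t /\ (W G).2 t <= B.
Proof.
elim: s => [|G s [B hB]]; first by exists 0.
have [C hC] := wall_bounded G; exists (Num.max B C) => H + t.
have BM : B <= Num.max B C by rewrite le_max lexx.
have CM : C <= Num.max B C by rewrite le_max lexx orbT.
by rewrite inE => /predU1P[->|/hB/(_ t)]; [have := hC t | idtac]; lra.
Qed.

(** * The temperature at which the scaffolds meet *)

Variable G : game.
Hypotheses (Lne : leftopts G != [::]) (Rne : rightopts G != [::]).
Local Notation wl := [seq W g | g <- leftopts G].
Local Notation wr := [seq W g | g <- rightopts G].

Let wl_ne : wl != [::]. Proof. by case: leftopts Lne. Qed.
Let wr_ne : wr != [::]. Proof. by case: rightopts Rne. Qed.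

Lemma meet_set_has_inf :
  has_inf [set t : R | -1 <= t /\ (lscaffold wl t <= rscaffold wr t)%E].
Proof.
split; last by exists (-1) => t [].
have [B hB] := walls_bounded (leftopts G ++ rightopts G).
(* At temperature [|B|] the left scaffold is at most [B - |B| <= 0] and the right one at least
   [|B| - B >= 0]. *)
exists `|B| => /=; split; first by have := normr_ge0 B; lra.
rewrite lscaffold_eqP //.
have [_ _ [u /mapP[g gG ->] ->]] := lscaffold_max `|B| wl_ne.
have [_ _ [v /mapP[h hG ->] ->]] := rscaffold_min `|B| wr_ne.
have [_] := hB g ltac:(by rewrite mem_cat gG) `|B|.
have [+ _] := hB h ltac:(by rewrite mem_cat hG orbT) `|B|.
by have := ler_norm B; lra.
Qed.

Lemma lt_meet_temp t : -1 <= t -> t < meet_temp wl wr ->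
  fine (rscaffold wr t) < fine (lscaffold wl t).
Proof.
move=> t1; apply: contraTT; rewrite -!leNgt => le.
by apply: ge_inf; [case: meet_set_has_inf | rewrite /= lscaffold_eqP].
Qed.

(** The left scaffold never rises and the right one never falls, so they have not met at any earlier
    temperature either. *)
Lemma meet_temp_ge t : fine (rscaffold wr t) < fine (lscaffold wl t) ->
  t <= meet_temp wl wr.
Proof.
move=> lt; apply: lb_le_inf; first by case: meet_set_has_inf.
move=> s [_]; rewrite lscaffold_eqP // => le; rewrite leNgt; apply/negP => /ltW st.
have := lscaffold_tame (@tame_map (leftopts G)) st.
by have := rscaffold_tame (@tame_map (rightopts G)) st; lra.
Qed.

(** The infimum is attained by continuity: both scaffolds move by at most the change in temperature,
    so a point of the set within [e / 2] costs at most [e]. *)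
Lemma at_meet_temp :
  fine (lscaffold wl (meet_temp wl wr)) <= fine (rscaffold wr (meet_temp wl wr)).
Proof.
set m := meet_temp wl wr; apply/ler_addgt0Pr => e e0.
have [t [t1 le] lt] := inf_adherent (divr_gt0 e0 (ltr0n R 2)) meet_set_has_inf.
rewrite -/(meet_temp wl wr) -/m in lt.
have mt : m <= t by apply: ge_inf; [case: meet_set_has_inf | split].
rewrite lscaffold_eqP // in le.
have := lscaffold_tame (@tame_map (leftopts G)) mt.
have := rscaffold_tame (@tame_map (rightopts G)) mt.
by lra.
Qed.

(* While Right gains at most [h] by moving and Left can gain [h], the mean of [G]
   is at least [phi]; the two scaffolds then cross at or after temperature [h]
   or else at a height of at least [phi]. *)
Lemma walls_ge_mean (phi h : R) : 0 <= h ->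
  ~ (exists kn, equals_number G kn) ->
  (forall H, H \in rightopts G -> forall t, 0 <= t -> phi - h <= (W H).1 t) ->
  (exists2 H, H \in leftopts G & forall t, 0 <= t <= h -> phi + t <= (W H).2 t) ->
  forall t, 0 <= t -> phi <= (W G).1 t /\ phi - h + Num.min t h <= (W G).2 t.
Proof.
move=> h0 nG Hr [K KG Hl] t t0; have [[kn eG]|[_ -> /=]] := WP G; first by case: nG; exists kn.
set m := meet_temp wl wr.
have lo s : 0 <= s <= h -> phi <= fine (lscaffold wl s).
  move=> /[dup] /Hl le _; have [_ /(_ (W K))] := lscaffold_max s wl_ne.
  by rewrite map_f // => /(_ isT) + _; lra.
have ro s : 0 <= s -> phi - h + s <= fine (rscaffold wr s).
  move=> s0; have [_ _ [v /mapP[g gG ->] ->]] := rscaffold_min s wr_ne.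
  by have := Hr g gG s s0; lra.
(* Below temperature 0 the left scaffold is at least its value at 0. *)
have lo' s : s <= h -> phi <= fine (lscaffold wl s).
  move=> sh; have [s0|s0] := leP 0 s; first by apply: lo; lra.
  have := lo 0; have := lscaffold_tame (@tame_map (leftopts G)) (ltW s0).
  by lra.
split.
- have [th|th] := leP (Num.min t m) h; first exact: lo'.
  have tm : Num.min t m <= m by rewrite ge_min lexx orbT.
  move: (Num.min t m) tm th => s sm hs.
  (* The midpoint lies before the meeting, so the left scaffold exceeds the right one there, which
     is at least [phi + (s - h) / 2]. Going on to [s] loses at most [(s - h) / 2]. *)
  have := lt_meet_temp (t := (s + h) / 2) ltac:(lra) ltac:(lra).
  have := ro ((s + h) / 2) ltac:(lra).
  have := lscaffold_tame (@tame_map (leftopts G)) (s := (s + h) / 2) (t := s) ltac:(lra).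
  by lra.
- have min_le : Num.min t h <= t /\ Num.min t h <= h by rewrite !ge_min !lexx orbT.
  (* Before the meeting the right scaffold suffices. After it, the wall is frozen at [m]: if
     [m <= h] its height is at least that of the left scaffold, otherwise [ro] alone exceeds
     [phi]. *)
  have [tm|mt] := leP t m; first by have := ro t t0; lra.
  have [mh|hm] := leP m h; first by have := at_meet_temp; have := lo' _ mh; rewrite -/m; lra.
  by have := ro m; lra.
Qed.

End Thermographic.

(** * Reflection of thermographs under negation *)

Definition mirror (W : game -> walls R) (G : game) : walls R :=
  (fun t => - (W (neg G)).2 t, fun t => - (W (neg G)).1 t).

Lemma lscaffold_mirror W (s : seq game) t :
  lscaffold [seq mirror W g | g <- s] t = (- rscaffold [seq W g | g <- map neg s] t)%E.
Proof.
rewrite /lscaffold /rscaffold !big_map; elim: s => [|g s IH]; first by rewrite !big_nil.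
by rewrite !big_cons IH oppe_min -EFinN /= opprD.
Qed.

Lemma rscaffold_mirror W (s : seq game) t :
  rscaffold [seq mirror W g | g <- s] t = (- lscaffold [seq W g | g <- map neg s] t)%E.
Proof.
rewrite /lscaffold /rscaffold !big_map; elim: s => [|g s IH]; first by rewrite !big_nil.
by rewrite !big_cons IH oppe_max -EFinN /= opprB addrC.
Qed.

Lemma equals_number_neg (G : game) (kn : int * nat) :
  equals_number (neg G) kn = equals_number G (- kn.1, kn.2).
Proof.
case: kn => k n; rewrite /equals_number /game_eq /= abszN.
have -> : dyadic n k = neg (dyadic n (- k)) by rewrite dyadic_neg opprK.
by rewrite !gle_neg; congr (_ && _); rewrite andbC.
Qed.

(** Negation exchanges the two scaffolds and their signs, so their inequality, and with it the
    meeting temperature, is unchanged. *)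
Lemma thermographic_mirror W : thermographic W -> thermographic (mirror W).
Proof.
move=> WP G; have [[kn eG WG]|[nG WG]] := WP (neg G).
  left; exists (- kn.1, kn.2); first by rewrite -equals_number_neg.
  by rewrite /mirror WG /dyval /= intrN mulNr.
right; split=> [[[k n] eG]|].
  by apply: nG; exists (- k, n); rewrite equals_number_neg /= opprK.
rewrite /= {1}/mirror WG /= leftopts_neg rightopts_neg.
set m := meet_temp _ _; set m' := meet_temp _ _.
have -> : m' = m.
  congr inf; apply/seteqP; split=> t [t1];
  by rewrite /= lscaffold_mirror rscaffold_mirror leeN2.
by congr (_, _); apply: funext => t; rewrite ?lscaffold_mirror ?rscaffold_mirror fineN.
Qed.

End Walls.

(** * Sums of stars *)

(* [Q m j q G] stands for "[G] is a position with [m] untouched stars whose centre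
   is reserved for Left, [j] further vertices reserved for Left and [q] isolated
   vertices open to both players". Only those moves of Left that her strategy
   needs are recorded, except at the end. *)
Record star_family (Q : nat -> nat -> nat -> game -> Prop) : Prop := StarFamily {
  right_move m j q G H : Q m j q G -> H \in rightopts G ->
    (exists m' q', m = m'.+1 /\ Q m' j q' H) \/ (exists2 q', q = q'.+1 & Q m j q' H);
  right_can_move m j q G : Q m j q G -> (0 < m + q)%N -> rightopts G != [::];
  left_star m j q G : Q m.+1 j q G -> exists2 H, H \in leftopts G & Q m (j + 4)%N q H;
  left_open m j q G : Q m j q.+1 G -> exists2 H, H \in leftopts G & Q m j q H;
  left_reserved m j q G : Q m j.+1 q G -> exists2 H, H \in leftopts G & Q m j q H;
  left_move_end j G H : Q 0%N j 0%N G -> H \in leftopts G ->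
    exists2 j', j = j'.+1 & Q 0%N j' 0%N H }.

Section StarFamily.
Variable Q : nat -> nat -> nat -> game -> Prop.
Hypothesis QP : star_family Q.

(* Left answers on an open vertex whenever Right colours one. *)
Lemma no_star_parity G j q : Q 0%N j q G ->
  if odd q then forall y : int, y <= j%:Z -> ~~ gle G (intgame y)
  else forall y : int, y <= j%:Z -> gle (intgame y) G.
Proof.
elim/game_option_ind: G j q => G IHl IHr j q QG; case: ifP => odd_q y yj.
- case: q odd_q QG => // q odd_q QG; have [H HG QH] := left_open QP QG.
  apply: (left_gleN HG); have := IHl H HG _ _ QH.
  by move: odd_q => /=; case: (odd q) => //= _; apply.
- apply/gleP; split=> K.
  + rewrite leftopts_intgame; case: ifP => // y0; rewrite inE => /eqP->.
    case: j yj QG => [|j] yj QG; first lia.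
    have [H HG QH] := left_reserved QP QG.
    by apply: (left_gleN HG); have := IHl H HG _ _ QH; rewrite odd_q; apply; lia.
  + move=> KG; have [[m' [q' []]]//|[q' eq QK]] := right_move QP QG KG.
    have := IHr K KG _ _ QK.
    by move: odd_q; rewrite eq /=; case: (odd q') => //= _; apply.
Qed.

(** Open vertices behave like copies of [{0 | 0}], and both [j] and [j + {0 | 0}] lie strictly above
    [j - 1]. *)
Lemma no_star_order G j q : Q 0%N j q G -> forall y : int, y <= j%:Z - 1 ->
  gle (intgame y) G && ~~ gle G (intgame y).
Proof.
(* The strict half for even parity: a negative [y] offers Right the move to [y + 1 <= i]; otherwise
   [i] is positive and Left spends a reserved vertex. *)
have ev H i r : Q 0%N i r H -> ~~ odd r -> forall y : int, y <= i%:Z - 1 ->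
    ~~ gle H (intgame y).
  move=> QH ev_r y yi; have := no_star_parity QH; rewrite (negPf ev_r) => le.
  have [y0|y0] := ltP y 0.
    apply: (@right_gleN _ _ (intgame (y + 1))); first by rewrite rightopts_intgame y0 inE.
    by apply: le; lia.
  case: i QH yi {le} => [|i] QH yi; first lia.
  have [K KH QK] := left_reserved QP QH; apply: (left_gleN KH).
  by have := no_star_parity QK; rewrite (negPf ev_r); apply; lia.
move=> QG y yj; have := no_star_parity QG; case: ifP => odd_q par.
  rewrite par ?andbT; last by lia.
  apply/gleP; split=> K.
    by rewrite leftopts_intgame; case: ifP => // y0; rewrite inE => /eqP->; apply: par; lia.
  move=> KG; have [[m' [q' []]]//|[q' eq QK]] := right_move QP QG KG.
  by apply: (ev _ _ _ QK); [move: odd_q; rewrite eq /= => ->|].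
by rewrite par ?(ev _ _ _ QG) // ?odd_q //; lia.
Qed.

(* The summand [- 1] absorbs the parity of [q]. *)
Lemma star_order G m j q : Q m j q G ->
  (forall y : int, y <= j%:Z - 1 + (2 * m)%:Z -> ~~ gle G (intgame y)) /\
  (forall y : int, y <= j%:Z - 1 + (2 * m.-1)%:Z -> gle (intgame y) G).
Proof.
elim/game_option_ind: G m j q => G IHl IHr [|m] j q QG.
  by split=> y yj; have /andP[] := @no_star_order G j q QG y ltac:(lia).
have up (y : int) : y <= j%:Z - 1 + (2 * m.+1)%:Z -> ~~ gle G (intgame y).
  (* The four gained vertices pay 2 for the star used up and 2 for the star that [m.-1] discards. *)
  move=> yj; have [H HG QH] := left_star QP QG; apply: (left_gleN HG).
  by have [_] := IHl H HG _ _ _ QH; apply; lia.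
split=> // y yj; apply/gleP; split=> K.
  by rewrite leftopts_intgame; case: ifP => // y0; rewrite inE => /eqP->; apply: up; lia.
move=> KG; have [[m' [q' [[<-] QK]]]|[q' _ QK]] := right_move QP QG KG.
- by have [+ _] := IHr K KG _ _ _ QK; apply; lia.
- by have [+ _] := IHr K KG _ _ _ QK; apply; lia.
Qed.

(** Each move of Left uses up one of her [j] vertices. Together with [no_star_parity] this
    identifies such a position with the integer [j]. *)
Lemma all_reserved_eq G j : Q 0%N j 0%N G -> gle G (intgame j).
Proof.
elim/game_option_ind: G j => G IHl _ j QG; apply/gleP; split=> K.
  move=> KG; have [j' -> QK] := left_move_end QP QG KG.
  apply: (@left_gleN _ _ (intgame j')); last exact: IHl QK.
  by rewrite leftopts_intgame (_ : j'.+1%:Z - 1 = j') ?inE //; lia.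
by rewrite rightopts_intgame.
Qed.

(** * Walls of sums of stars *)

Section Walls.
Variables (R : realType) (W : game -> walls R).
Hypothesis WP : thermographic W.

(** The temperature of the hottest summand: a star [{4 | 0}] if there is one, otherwise an open
    vertex [{0 | 0}]. *)
Definition star_heat (m : nat) : R := if m is 0%N then 0 else 2.

Lemma star_walls G m j q : Q m j q G -> forall t : R, 0 <= t ->
  let phi := j%:R - 1 + 2 * m%:R in
  phi <= (W G).1 t /\ phi - star_heat m + Num.min t (star_heat m) <= (W G).2 t.
Proof.
elim/game_option_ind: G m j q => G IHl IHr m j q QG t t0 /=.
have [[kn eG WG]|[nG _]] := WP G.
  have := game_eq_dyadic_gt R eG (proj1 (star_order QG) _ (lexx _)).
  rewrite WG /= intrD intrB PoszM intrM /= -!pmulrn => lt.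
  have : Num.min t (star_heat m) <= star_heat m by rewrite ge_min lexx orbT.
  by lra.
(* Otherwise [G] would equal the integer [j], against [nG]. *)
have mq : (0 < m + q)%N.
  rewrite lt0n addn_eq0; apply/negP => /andP[/eqP m0 /eqP q0]; apply: nG.
  exists (j%:Z, 0%N); rewrite /equals_number /game_eq /=.
  rewrite m0 q0 in QG; rewrite (all_reserved_eq QG) /= andbT.
  by have /= le := no_star_parity QG; exact: (le j%:Z).
have Rne := right_can_move QP QG mq.
have heat0 k : 0 <= star_heat k by case: k => [|k] /=; lra.
have [K KG Kt] : exists2 K, K \in leftopts G & forall t : R, 0 <= t <= star_heat m ->
    j%:R - 1 + 2 * m%:R + t <= (W K).2 t.
  case: m mq {heat0 Rne} QG => [|m] mq QG.
    case: q mq QG => // q _ QG; have [K KG QK] := left_open QP QG.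
    exists K => // s /= s0; have [_] := IHl K KG _ _ _ QK s ltac:(lra).
    by rewrite /= (_ : s = 0) ?minxx; lra.
  (* Taking a centre raises [phi] by 2. If stars remain, induction gives [phi + 2 - 2 + s]; if none
     remains it gives [phi + 2], enough since [s <= 2]. *)
  have [K KG QK] := left_star QP QG; exists K => // s /= s02.
  have [_] := IHl K KG _ _ _ QK s ltac:(lra); rewrite natrD -[in 2 * m.+1%:R]natr1.
  by case: (m) => [|m'] /=; [rewrite min_r | rewrite min_l]; lra.
have Lne : leftopts G != [::] by apply: contraTneq KG => ->.
apply: (walls_ge_mean WP Lne Rne) => //; last by exists K.
(* Spoiling a star lowers [phi] by 2, exactly the heat; taking an open vertex leaves [phi]
   unchanged. *)
move=> H HG s s0; have [[m' [q' [-> QH]]]|[q' _ QH]] := right_move QP QG HG.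
  by have [+ _] := IHr H HG _ _ _ QH s s0; rewrite /= -natr1; lra.
by have [+ _] := IHr H HG _ _ _ QH s s0; have := heat0 m; lra.
Qed.

End Walls.
End StarFamily.

(** * Snort on a tree *)

Section SnortPositions.
Variables (T : finType) (e : rel T).

(** With the exact count of uncoloured vertices as fuel, the game depends on the colouring alone,
    and each legal move consumes one unit. *)
Definition position (c : colouring T) : game :=
  snort_fuel e #|[set v | c v == None]| c.

Definition swap (c : colouring T) : colouring T := [ffun v => omap negb (c v)].

Lemma snort_moveE (c : colouring T) b v u :
  snort_move c b v u = if u == v then Some b else c u.
Proof. by rewrite ffunE. Qed.

Lemma position_options (c : colouring T) :
  position c =
  Game [seq position (snort_move c true v) | v <- enum T & snort_legal e c true v]
       [seq position (snort_move c false v) | v <- enum T & snort_legal e c false v].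
Proof.
have card_move b v : snort_legal e c b v ->
    #|[set u | c u == None]| = #|[set u | snort_move c b v u == None]|.+1.
  case/andP=> cv _; rewrite (cardsD1 v) inE cv add1n; congr _.+1.
  apply: eq_card => u; rewrite !inE snort_moveE; by case: eqP.
rewrite {1}/position; case E: #|[set v | c v == None]| => [|n] /=.
  have none b : [seq v <- enum T | snort_legal e c b v] = [::].
    apply/eqP; rewrite -[_ == _]negbK -has_filter; apply/hasPn => v _.
    by apply/negP => /card_move; rewrite E.
  by rewrite !none.
congr Game; apply/eq_in_map => v; rewrite mem_filter => /andP[/card_move];
by rewrite E => -[En] _; rewrite /position -En.
Qed.

Lemma snortE : snort e = position [ffun=> None].
Proof.
rewrite /snort /position -cardsT; congr (snort_fuel _ _ _); apply: eq_card => v.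
by rewrite !inE ffunE.
Qed.

Lemma mem_leftopts (c : colouring T) G :
  G \in leftopts (position c) <->
  exists2 v, snort_legal e c true v & G = position (snort_move c true v).
Proof.
rewrite position_options; split=> [/mapP[v]|[v lv ->]].
  by rewrite mem_filter => /andP[lv _] ->; exists v.
by apply: map_f; rewrite mem_filter lv mem_enum.
Qed.

Lemma mem_rightopts (c : colouring T) G :
  G \in rightopts (position c) <->
  exists2 v, snort_legal e c false v & G = position (snort_move c false v).
Proof.
rewrite position_options; split=> [/mapP[v]|[v lv ->]].
  by rewrite mem_filter => /andP[lv _] ->; exists v.
by apply: map_f; rewrite mem_filter lv mem_enum.
Qed.

Lemma neg_position (c : colouring T) : neg (position c) = position (swap c).
Proof.
have swap_move d b v : swap (snort_move d b v) = snort_move (swap d) (~~ b) v.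
  by apply/ffunP => u; rewrite !ffunE; case: ifP.
have swap_legal d b v : snort_legal e (swap d) b v = snort_legal e d (~~ b) v.
  rewrite /snort_legal ffunE; congr (_ && _); first by case: (d v).
  by apply: eq_forallb => u; rewrite ffunE; case: (d u) b => [[]|] [].
rewrite /position; have -> : [set v | swap c v == None] = [set v | c v == None].
  by apply/setP => v; rewrite !inE ffunE; case: (c v).
move: #|[set v | c v == None]| => n; elim: n c => //= n IH c.
have filter_swap b : [seq v <- enum T | snort_legal e (swap c) b v] =
    [seq v <- enum T | snort_legal e c (~~ b) v].
  by apply: eq_filter => v; rewrite swap_legal.
rewrite !filter_swap -!map_comp.
by congr Game; apply: eq_map => v /=; rewrite IH swap_move.
Qed.

End SnortPositions.

Section StarTree.
Variable n : nat.

(** [None] is the root. *)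
Definition star_tree := option ('I_n * option 'I_4).
Definition centre (i : 'I_n) : star_tree := Some (i, None).
Definition leaf (x : 'I_n * 'I_4) : star_tree := Some (x.1, Some x.2).

Definition tree_edge : rel star_tree := fun v w =>
  match v, w with
  | None, Some (_, None) | Some (_, None), None => true
  | Some (i, None), Some (j, Some _) | Some (j, Some _), Some (i, None) => i == j
  | _, _ => false
  end.

Lemma tree_edge_simple : simple_graph tree_edge.
Proof. by split=> [[[i [a|]]|] [[j [b|]]|]|[[i [a|]]|]]. Qed.

(** A leaf has one neighbour, a centre the root and four leaves, and the root the [n] centres. *)
Lemma max_degree_star_tree : (max_degree tree_edge <= maxn n 5)%N.
Proof.
apply/bigmax_leqP => v _; rewrite leq_max; case: v => [[i [a|]]|].
- rewrite (_ : [set u | _] = [set centre i]) ?cards1 ?orbT //.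
  apply/setP => -[[j [b|]]|]; rewrite !inE //= (inj_eq Some_inj) xpair_eqE /=.
    by rewrite andbF.
  by rewrite andbT.
- have -> : [set u | tree_edge (Some (i, None)) u] = None |: [set leaf (i, a) | a : 'I_4].
    apply/setP => -[[j [b|]]|]; rewrite !inE //=.
    + apply/eqP/imsetP => [<-|[a _ [-> _]]//]; by exists b.
    + by apply/esym/negbTE/imsetP => -[].
  rewrite cardsU1; apply/orP; right.
  by rewrite (leq_add (leq_b1 _) (leq_trans (leq_imset_card _ _) _)) // card_ord.
- have -> : [set u | tree_edge None u] = [set centre i | i : 'I_n].
    apply/setP => -[[j [b|]]|]; rewrite !inE //=.
    + by apply/esym/negbTE/imsetP => -[].
    + by apply/esym/imsetP; exists j.
    + by apply/esym/negbTE/imsetP => -[].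
  by rewrite (leq_trans (leq_imset_card _ _)) // card_ord.
Qed.

(** * Positions in which Left holds the root *)

Implicit Types (c : colouring star_tree) (i : 'I_n) (x : 'I_n * 'I_4).

Definition untouched c i :=
  (c (centre i) == None) && [forall a, c (leaf (i, a)) == None].
Definition spoiled c i := [exists a, c (leaf (i, a)) == Some false].
Definition reserved c := [set x | (c (centre x.1) == Some true) && (c (leaf x) == None)].
(** When the root is blue, a red leaf makes its uncoloured centre unplayable for both players, so
    the remaining leaves act as isolated vertices. *)
Definition opened c := [set x | spoiled c x.1 && (c (leaf x) == None)].

(** The invariant kept as long as Left colours no leaf of an untouched star; a star with blue leaves
    only and an uncoloured centre then never arises. *)
Definition left_rooted c := c None = Some true /\ forall i,
  [\/ untouched c i, c (centre i) = None /\ spoiled c i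
    | c (centre i) = Some true /\ ~~ spoiled c i].

Lemma legal_leaf c b x : snort_legal tree_edge c b (leaf x) =
  (c (leaf x) == None) && (c (centre x.1) != Some (~~ b)).
Proof.
rewrite /snort_legal; congr (_ && _); apply/forallP/idP => [/(_ (centre x.1))|nc].
  by rewrite /= eqxx.
by move=> [[j [a|]]|] //=; apply/implyP => /eqP->.
Qed.

Lemma legal_untouched_centre c i : left_rooted c -> untouched c i ->
  snort_legal tree_edge c true (centre i).
Proof.
move=> [root _] /andP[ci /forallP li]; rewrite /snort_legal ci /=.
apply/forallP => -[[j [a|]]|] //=; last by rewrite root.
by apply/implyP => /eqP <-; rewrite (eqP (li a)).
Qed.

Lemma illegal_centre c i : c None = Some true ->
  ~~ snort_legal tree_edge c false (centre i).
Proof.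
move=> root; rewrite negb_and negb_forall; apply/orP; right.
by apply/existsP; exists None; rewrite /= root.
Qed.

Lemma illegal_spoiled_centre c i : spoiled c i ->
  ~~ snort_legal tree_edge c true (centre i).
Proof.
case/existsP => a /eqP ca; rewrite negb_and negb_forall; apply/orP; right.
by apply/existsP; exists (leaf (i, a)); rewrite /= eqxx ca.
Qed.

Section LeafMove.
Variables (c : colouring star_tree) (b : bool) (x : 'I_n * 'I_4).
Hypothesis cx : c (leaf x) = None.
Let c' := snort_move c b (leaf x).

Lemma leaf_move_centre i : c' (centre i) = c (centre i).
Proof. by rewrite snort_moveE; case: eqP => // -[]. Qed.

Lemma leaf_move_leaf y : c' (leaf y) = if y == x then Some b else c (leaf y).
Proof.
by rewrite snort_moveE; congr (if _ then _ else _).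
Qed.

Lemma leaf_move_untouched i : untouched c' i = untouched c i && (i != x.1).
Proof.
rewrite /untouched leaf_move_centre -andbA; congr (_ && _).
apply/forallP/andP => [h|[/forallP h ix] a]; last first.
  rewrite leaf_move_leaf; case: ((i, a) =P x) => [ex|_]; last exact: h.
  by rewrite -ex eqxx in ix.
split.
  apply/forallP => a; have := h a.
  by rewrite leaf_move_leaf; case: ((i, a) =P x) => // ->; rewrite cx.
by apply/eqP => ix; have := h x.2; rewrite leaf_move_leaf ix -surjective_pairing eqxx.
Qed.

Lemma leaf_move_spoiled i : spoiled c' i = spoiled c i || ~~ b && (i == x.1).
Proof.
apply/existsP/orP => [[a]|[/existsP[a ca]|/andP[nb /eqP->]]].
- rewrite leaf_move_leaf; case: ((i, a) =P x) => [<- /= |_ ca].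
    by case: b => // _; right; rewrite eqxx.
  by left; apply/existsP; exists a.
- by exists a; rewrite leaf_move_leaf; case: ((i, a) =P x) ca => // ->; rewrite cx.
- by exists x.2; rewrite leaf_move_leaf -surjective_pairing eqxx; case: b nb.
Qed.

Lemma leaf_move_reserved : reserved c' = reserved c :\ x.
Proof.
apply/setP => y; rewrite !inE leaf_move_centre leaf_move_leaf.
by case: (y =P x) => [_|_] //=; rewrite andbF.
Qed.

(** The condition excludes the first red leaf of a star, which would open the other leaves. *)
Lemma leaf_move_opened : b || spoiled c x.1 -> opened c' = opened c :\ x.
Proof.
move=> bs; apply/setP => y; rewrite !inE leaf_move_spoiled leaf_move_leaf.
case: (y =P x) => [_|_] /=; first by rewrite andbF.
case: (y.1 =P x.1) => [->|_]; last by rewrite andbF orbF.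
by case: b bs => /= [_|->] //; rewrite orbF.
Qed.

Lemma leaf_move_rooted : left_rooted c -> c (centre x.1) != Some (~~ b) ->
  (b -> ~~ untouched c x.1) -> left_rooted c'.
Proof.
move=> [root st] cb nu; split; first by rewrite snort_moveE.
move=> i; rewrite leaf_move_untouched leaf_move_spoiled leaf_move_centre.
have [->|ix] /= := eqVneq i x.1; last by rewrite andbF orbF andbT; apply: st.
rewrite andbF andbT; have [u|[-> ->]|[cT ns]] := st x.1.
- by case: b nu => [/(_ isT)/negP//|_]; case/andP: u => /eqP-> _; rewrite orbT; apply: Or32.
- exact: Or32.
- by rewrite cT in cb *; case: b cb => //= _; rewrite orbF; apply: Or33.
Qed.

End LeafMove.

Section CentreMove.
Variables (c : colouring star_tree) (i : 'I_n).
Hypothesis ci : untouched c i.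
Let c' := snort_move c true (centre i).

Lemma centre_move_leaf x : c' (leaf x) = c (leaf x).
Proof. by rewrite snort_moveE; case: eqP => // -[]. Qed.

Lemma centre_move_centre j : c' (centre j) = if j == i then Some true else c (centre j).
Proof. by rewrite snort_moveE (inj_eq Some_inj) xpair_eqE andbT. Qed.

Lemma centre_move_spoiled j : spoiled c' j = spoiled c j.
Proof. by apply: eq_existsb => a; rewrite centre_move_leaf. Qed.

Lemma centre_move_untouched j : untouched c' j = untouched c j && (j != i).
Proof.
rewrite /untouched centre_move_centre; case: (j =P i) => [_|_] /=; first by rewrite andbF.
by rewrite andbT; congr (_ && _); apply: eq_forallb => a; rewrite centre_move_leaf.
Qed.

Lemma centre_move_opened : opened c' = opened c.
Proof. by apply/setP => x; rewrite !inE centre_move_spoiled centre_move_leaf. Qed.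

Lemma card_centre_move_reserved : #|reserved c'| = (#|reserved c| + 4)%N.
Proof.
have /andP[/eqP ciN /forallP li] := ci.
have -> : reserved c' = reserved c :|: [set (i, a) | a : 'I_4].
  apply/setP => -[j a]; rewrite !inE centre_move_centre centre_move_leaf /=.
  have [->|ji] := eqVneq j i.
    by rewrite li eqxx /= orbC; apply/esym/orP; left; apply/imsetP; exists a.
  by case: imsetP => [[d _ [E _]]|]; rewrite ?orbF //; rewrite E eqxx in ji.
rewrite cardsU disjoint_setI0 ?cards0 ?subn0.
  by rewrite card_imset ?card_ord // => a d [].
rewrite -setI_eq0; apply/eqP/setP => x; rewrite !inE; apply/negP.
by case/andP => /andP[/eqP + _] /imsetP[a _ E]; rewrite E /= ciN.
Qed.

Lemma centre_move_rooted : left_rooted c -> left_rooted c'.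
Proof.
move=> [root st]; split; first by rewrite snort_moveE.
move=> j; rewrite centre_move_untouched centre_move_spoiled centre_move_centre.
have [->|ji] := eqVneq j i; last by rewrite andbT; apply: st.
apply: Or33; split=> //; have /andP[_ /forallP li] := ci.
by apply/existsPn => a; rewrite (eqP (li a)).
Qed.

End CentreMove.

Definition tree_family (m j q : nat) (G : game) : Prop := exists c,
  [/\ G = position tree_edge c, left_rooted c, m = #|[set i | untouched c i]|,
      j = #|reserved c| & q = #|opened c|].

(** The leaf belongs to only one of the two sets, depending on the state of its star; removing it
    from both covers all cases at once. *)
Lemma tree_family_leaf (c : colouring star_tree) b x : left_rooted c ->
  snort_legal tree_edge c b (leaf x) -> ~~ untouched c x.1 ->
  tree_family #|[set i | untouched c i]| #|reserved c :\ x| #|opened c :\ x|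
    (position tree_edge (snort_move c b (leaf x))).
Proof.
move=> rc; rewrite legal_leaf => /andP[/eqP cx cb] nu.
exists (snort_move c b (leaf x)); split=> //.
- exact: leaf_move_rooted.
- apply: eq_card => i; rewrite !inE leaf_move_untouched //.
  by case: (i =P x.1) => [->|_]; rewrite ?andbT // (negPf nu).
- by rewrite leaf_move_reserved.
- have [_ /(_ x.1)[u|[_ sp]|[cT ns]]] := rc; first by rewrite u in nu.
    by rewrite leaf_move_opened // sp orbT.
  by rewrite leaf_move_opened //; move: cb; rewrite cT; case: (b).
Qed.

Lemma tree_star_family : star_family tree_family.
Proof.
have pick_in (T : finType) (A : {set T}) k : k.+1 = #|A| ->
    exists2 x, x \in A & k = #|A :\ x|.
  move=> kA; have /card_gt0P[x xA] : (0 < #|A|)%N by rewrite -kA.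
  by exists x => //; move: kA; rewrite (cardsD1 x A) xA => -[].
have cardsD1_notin (T : finType) (A : {set T}) (x : T) : x \notin A -> #|A :\ x| = #|A|.
  by move=> xA; rewrite [in RHS](cardsD1 x A) (negPf xA).
split.
- move=> _ _ _ _ H [c [-> rc -> -> ->]] /mem_rightopts[v lv ->].
  (* The blue root keeps Right off the centres, so he plays a leaf: in an untouched star he spoils
     it, in a spoiled one he uses up an open leaf. *)
  have [root st] := rc; case: v lv => [[i [a|]]|] lv; last first.
  + by move: lv; rewrite /snort_legal root.
  + by move: lv; rewrite (negPf (illegal_centre _ root)).
  rewrite -[Some _]/(leaf (i, a)) in lv *.
  have := lv; rewrite legal_leaf => /andP[/eqP la ci].
  have [u|[ciN sp]|[cT _]] := st i; last by rewrite /= cT in ci.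
  + have /andP[/eqP ciN _] := u.
    left; exists #|[set k | untouched c k] :\ i|, #|opened (snort_move c false (leaf (i, a)))|.
    split; first by rewrite (cardsD1 i [set k | _]) inE u.
    exists (snort_move c false (leaf (i, a))); split=> //.
    * exact: leaf_move_rooted.
    * by apply: eq_card => k; rewrite !inE leaf_move_untouched // andbC.
    * by rewrite leaf_move_reserved // cardsD1_notin // inE ciN.
  + right; exists #|opened c :\ (i, a)|; first by rewrite (cardsD1 (i, a) (opened c)) inE la sp.
    rewrite -[#|reserved c|](cardsD1_notin _ _ (i, a)) ?inE ?ciN //.
    apply: tree_family_leaf => //; apply/negP => /andP[_ /forallP un].
    by case/existsP: sp => d; rewrite (eqP (un d)).
- move=> m j q _ [c [-> [root st] -> _ ->]] mq.
  suff [v lv] : exists v, snort_legal tree_edge c false v.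
    have : position tree_edge (snort_move c false v) \in rightopts (position tree_edge c).
      by apply/mem_rightopts; exists v.
    by apply: contraTneq => ->.
  have [] : (0 < #|[set i | untouched c i]|)%N \/ (0 < #|opened c|)%N by lia.
    move=> /card_gt0P[i]; rewrite inE => /andP[/eqP ciN /forallP li].
    by exists (leaf (i, ord0)); rewrite legal_leaf li ciN.
  move=> /card_gt0P[x]; rewrite inE => /andP[sp lx]; exists (leaf x).
  rewrite legal_leaf lx; have [/andP[/eqP-> _]|[-> _]|[_]] // := st x.1.
  by rewrite sp.
- move=> m _ _ _ [c [-> rc mE -> ->]].
  have [i + ->] := pick_in _ _ _ mE; rewrite inE => ui.
  exists (position tree_edge (snort_move c true (centre i))).
    by apply/mem_leftopts; exists (centre i) => //; apply: legal_untouched_centre.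
  exists (snort_move c true (centre i)); split=> //.
  + exact: centre_move_rooted.
  + by apply: eq_card => k; rewrite !inE centre_move_untouched // andbC.
  + by rewrite card_centre_move_reserved.
  + by rewrite centre_move_opened.
- move=> _ _ q _ [c [-> rc -> -> qE]].
  have [x + ->] := pick_in _ _ _ qE; rewrite inE => /andP[sp lx].
  have [root st] := rc.
  have nu : ~~ untouched c x.1.
    apply/negP => /andP[_ /forallP un].
    by case/existsP: sp => d; rewrite (eqP (un d)).
  have ciN : c (centre x.1) = None by have [/(negP nu)|[]|[_ /negP]] := st x.1.
  have lv : snort_legal tree_edge c true (leaf x) by rewrite legal_leaf lx ciN.
  exists (position tree_edge (snort_move c true (leaf x))).
    by apply/mem_leftopts; exists (leaf x).
  rewrite -[#|reserved c|](cardsD1_notin _ _ x) ?inE ?ciN //.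
  exact: tree_family_leaf.
- move=> _ j _ _ [c [-> rc -> jE ->]].
  have [x + ->] := pick_in _ _ _ jE; rewrite inE => /andP[/eqP cT lx].
  have [root st] := rc.
  have lv : snort_legal tree_edge c true (leaf x) by rewrite legal_leaf lx cT.
  have nu : ~~ untouched c x.1 by rewrite /untouched cT.
  have ns : ~~ spoiled c x.1 by have [/(negP nu)|[]|[]] := st x.1; rewrite ?cT.
  exists (position tree_edge (snort_move c true (leaf x))).
    by apply/mem_leftopts; exists (leaf x).
  rewrite -[#|opened c|](cardsD1_notin _ _ x) ?inE ?(negPf ns) //.
  exact: tree_family_leaf.
- move=> _ _ H [c [-> rc mE -> qE]] /mem_leftopts[v lv ->].
  have [root st] := rc.
  have nu i : ~~ untouched c i.
    by apply/negP => ui; have := card0_eq (esym mE) i; rewrite !inE ui.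
  (* Every centre is now blue or blocked by a red leaf and no open leaf remains, so Left can only
     take a reserved leaf. *)
  case: v lv => [[i [a|]]|] lv; last first.
  + by move: lv; rewrite /snort_legal root.
  + have [ui|[_ sp]|[cT _]] := st i; first by case/negP: (nu i).
      by move: lv; rewrite (negPf (illegal_spoiled_centre sp)).
    by move: lv; rewrite /snort_legal cT.
  rewrite -[Some _]/(leaf (i, a)) in lv *.
  have := lv; rewrite legal_leaf => /andP[la ci].
  have nsp : (i, a) \notin opened c by rewrite (card0_eq (esym qE)).
  have [ui|[_ sp]|[cT _]] := st i; first by case/negP: (nu i).
    by rewrite inE la sp in nsp.
  exists #|reserved c :\ (i, a)|; first by rewrite (cardsD1 (i, a) (reserved c)) inE la cT.
  rewrite [X in tree_family X]mE [X in tree_family _ _ X]qE -(cardsD1_notin _ _ _ nsp).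
  exact: tree_family_leaf.
Qed.

End StarTree.

(** * The opening move at the root and the temperature of the tree *)

Definition rooted (n : nat) (b : bool) : colouring (star_tree n) :=
  snort_move [ffun=> None] b None.

Lemma tree_family_rooted n : tree_family n n 0 0 (position (@tree_edge n) (rooted n true)).
Proof.
have vE (v : star_tree n) : v != None -> rooted n true v = None.
  by rewrite snort_moveE ffunE => /negPf->.
have un i : untouched (rooted n true) i.
  by rewrite /untouched vE // eqxx; apply/forallP => a; rewrite vE.
exists (rooted n true); split=> //.
- by split=> [|i]; [rewrite snort_moveE | apply: Or31].
- by rewrite -[LHS]card_ord -cardsT; apply: eq_card => i; rewrite !inE un.
- by apply/esym/eq_card0 => x; rewrite inE vE.
- apply/esym/eq_card0 => x; rewrite inE; apply/negP => /andP[/existsP[a]].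
  by rewrite vE.
Qed.

Lemma neg_rooted n :
  neg (position (@tree_edge n) (rooted n true)) = position (@tree_edge n) (rooted n false).
Proof.
rewrite neg_position; congr position; apply/ffunP => v.
by rewrite !ffunE; case: ifP => //; rewrite ffunE.
Qed.

Lemma neg_snort (T : finType) (e : rel T) : neg (snort e) = snort e.
Proof.
by rewrite snortE neg_position; congr position; apply/ffunP => v; rewrite !ffunE.
Qed.

Lemma rooted_option n :
  position (@tree_edge n) (rooted n true) \in leftopts (snort (@tree_edge n)) /\
  position (@tree_edge n) (rooted n false) \in rightopts (snort (@tree_edge n)).
Proof.
have legal b : snort_legal (@tree_edge n) [ffun=> None] b None.
  by rewrite /snort_legal ffunE /=; apply/forallP => u; rewrite ffunE implybT.
by rewrite snortE; split; [apply/mem_leftopts | apply/mem_rightopts]; exists None.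
Qed.

(** The empty board is its own negative, so a number equal to it would be equal to its opposite too.
    Left's move at the root to a position at least 0 would make both positive. *)
Lemma snort_tree_not_number (R : realType) n : (1 < n)%N ->
  ~ exists kn, equals_number (snort (@tree_edge n)) kn.
Proof.
move=> n1 [[k d] eG]; have [LG _] := rooted_option n.
have nle : ~~ gle (snort (@tree_edge n)) (intgame 0).
  apply: (left_gleN LG).
  by have [_] := star_order (tree_star_family n) (tree_family_rooted n); apply; lia.
have eG' : equals_number (snort (@tree_edge n)) (- k, d).
  by rewrite -(equals_number_neg _ (k, d)) neg_snort.
have := game_eq_dyadic_gt R eG nle; have := game_eq_dyadic_gt R eG' nle.
by rewrite /dyval /= intrN mulNr; lra.
Qed.

Lemma temperature_snort_tree (R : realType) n : (1 < n)%N ->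
  2 * n%:R - 2 <= temperature R (snort (@tree_edge n)).
Proof.
move=> n1; set G := snort _; have [LG RG] := rooted_option n.
have WP := thermograph_thermographic R.
have Lne : leftopts G != [::] by apply: contraTneq LG => ->.
have Rne : rightopts G != [::] by apply: contraTneq RG => ->.
rewrite /temperature /number_of; case: pselect => [/(snort_tree_not_number R n1)//|_].
have n2 : 2 <= n%:R :> R by rewrite ler_nat.
(* This is 1 below the bound [2 n - 1] on the mean after the root is taken, so the left scaffold is
   at least 1 and, by reflection, the right one at most -1. As [t >= 2], the walls have already
   reached that bound. *)
set t := 2 * n%:R - 2.
have tmin : Num.min t 2 = 2 by apply: min_r; rewrite /t; lra.
have t0 : 0 <= t by rewrite /t; lra.
have low W : thermographic W -> 1 <= (W (position (@tree_edge n) (rooted n true))).2 t - t.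
  move=> WP'; have [_] := star_walls (tree_star_family n) WP' (tree_family_rooted n) t0.
  have -> : star_heat R n = 2 by case: (n) n1.
  by rewrite tmin /t; lra.
apply: (meet_temp_ge WP Lne Rne).
have := low _ WP; have := low _ (thermographic_mirror WP).
rewrite /= neg_rooted.
have wlne : [seq thermograph R g | g <- leftopts G] != [::] by case: leftopts Lne.
have wrne : [seq thermograph R g | g <- rightopts G] != [::] by case: rightopts Rne.
have [_ /(_ _ (map_f _ LG)) le _] := lscaffold_max t wlne.
have [_ /(_ _ (map_f _ RG)) ge _] := rscaffold_min t wrne.
by lra.
Qed.

Unset Implicit Arguments.

Theorem theorem10 (R : realType) (M : R) :
  exists (T : finType) (e : rel T),
    simple_graph e /\ M < temperature R (snort e) - (max_degree e)%:R.
Proof.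
(* The difference is at least [(2 n - 2) - n = n - 2], which exceeds [M]; the summand 5 also makes
   [n] the maximum in [maxn n 5]. *)
pose n := (Num.bound `|M| + 5)%N.
exists (star_tree n), (@tree_edge n); split; first exact: tree_edge_simple.
have := @temperature_snort_tree R n ltac:(rewrite /n; lia).
have : (max_degree (@tree_edge n))%:R <= n%:R :> R.
  by rewrite ler_nat (leq_trans (max_degree_star_tree n)) // geq_max leqnn /n leq_addl.
have : `|M| + 5 < n%:R by rewrite natrD ltrD2r archi_boundP.
by have := ler_norm M; lra.
Qed.
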